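(* Let $\{\mu_i\}_i$ and $\mu$ be varifolds in $\mathcal{V}_d$ and assume that $\mu_i\to\mu$ with respect to the operator norm (i.e. $d_{op}(\mu_i,\mu)\to0$) or with respect to the narrow topology. Then $\mu_i\to\mu$ in $W^*$, i.e. $\|\mu_i-\mu\|_{W^*}\to0$.
   Context: Let $0\le d\le n$. $\widetilde{G}^n_d$ is the set of oriented $d$-dimensional linear subspaces of $\mathbb{R}^n$, identified with a subset of the unit sphere of $\Lambda^d(\mathbb{R}^n)$ by $T\mapsto \frac{u_1\wedge\cdots\wedge u_d}{|u_1\wedge\cdots\wedge u_d|}$ for any basis $(u_i)$ of $T$ consistent with its orientation (inner product $\langle \xi_1\wedge\cdots\wedge\xi_d,\eta_1\wedge\cdots\wedge\eta_d\rangle=\det(\xi_i\cdot\eta_j)_{i,j}$), with the induced topology. $\mathcal{V}_d$ is the set of oriented $d$-varifolds, i.e. nonnegative finite Radon measures on $\mathbb{R}^n\times\widetilde{G}^n_d$, and $(\mu|\omega)=\int\omega\,d\mu$. $d_{op}(\mu,\nu)=\sup\{(\mu-\nu|\omega):\omega\in C_0(\mathbb{R}^n\times\widetilde{G}^n_d),\ \|\omega\|_\infty\le1\}$. Narrow convergence $\mu_i\to\mu$ means $(\mu_i|\omega)\to(\mu|\omega)$ for all bounded continuous $\omega$ on $\mathbb{R}^n\times\widetilde{G}^n_d$. Standing assumptions on kernels: $k^{pos}$ and $k^G$ are continuous positive definite kernels on $\mathbb{R}^n$ and $\widetilde{G}^n_d$ respectively, with $k^{pos}(x,\cdot)\in C_0(\mathbb{R}^n)$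 for every $x$ ($C_0$: continuous functions vanishing at infinity). $W$ is the reproducing kernel Hilbert space of $k((x,T),(x',T'))=k^{pos}(x,x')k^G(T,T')$; it is continuously embedded in $C_0(\mathbb{R}^n\times\widetilde{G}^n_d)$. For a finite signed Radon measure $\mu$, $\|\mu\|_{W^*}=\sup_{\omega\in W,\|\omega\|_W\le1}|(\mu|\omega)|$, equivalently $\|\mu\|_{W^*}^2=\iint k\,d\mu\,d\mu$. No injectivity of $\mu\mapsto(\mu|\cdot)|_W$ is assumed. *)

(* Defs.v *)
From HB Require Import structures.
From mathcomp Require Import all_boot all_order all_algebra all_fingroup.
From mathcomp Require Import all_classical all_reals all_analysis.
Set Implicit Arguments.
Unset Strict Implicit.
Unset Printing Implicit Defensive.
Import Order.TTheory GRing.Theory Num.Theory.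
Import numFieldNormedType.Exports.
Local Open Scope classical_set_scope.
Local Open Scope ring_scope.

(* Strictly increasing maps I : {0..d-1} -> {0..n-1}. They index the basis
   e_I = e_(I 0) /\ ... /\ e_(I (d-1)) of the exterior power of R^n. *)
Definition multi_index (n d : nat) :=
  {I : {ffun 'I_d -> 'I_n} |
    [forall i : 'I_d, forall j : 'I_d, (i < j)%N ==> (I i < I j)%N]}.

Section Cauchy_Binet.
Context (R : comNzRingType) (n d : nat).

Lemma multi_index_lt (I : multi_index n d) (i j : 'I_d) :
  (val I i < val I j)%N = (i < j)%N.
Proof.
have H (a b : 'I_d) : (a < b)%N -> (val I a < val I b)%N.
  by move=> ab; have /forallP/(_ a)/forallP/(_ b)/implyP := valP I; apply.
case: (ltngtP i j) => [/H -> //|/H/ltnW|/val_inj->]; last by rewrite ltnn.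
by rewrite leqNgt => /negbTE.
Qed.

Lemma multi_index_inj (I : multi_index n d) : injective (val I).
Proof.
move=> i j e; apply/val_inj; case: (ltngtP i j) => //;
  by rewrite -(multi_index_lt I) e ltnn.
Qed.

Lemma multi_index_codom (I J : multi_index n d) :
  codom (val I) =i codom (val J) -> I = J.
Proof.
move=> eIJ; apply/val_inj/ffunP => i.
have srt (K : multi_index n d) : sorted ltn (map val (codom (val K))).
  rewrite codomE -map_comp sorted_map.
  have : sorted ltn (map val (enum 'I_d)) by rewrite val_enum_ord iota_ltn_sorted.
  rewrite sorted_map; apply: sub_sorted => a b /=.
  by rewrite multi_index_lt.
have : map val (codom (val I)) = map val (codom (val J)).
  apply: (irr_sorted_eq ssrnat.ltn_trans ltnn (srt I) (srt J)) => x.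
  by apply/mapP/mapP => -[y yI ->]; exists y => //; rewrite ?eIJ // -eIJ.
move/(inj_map val_inj); rewrite !codomE => /eq_in_map; apply.
by rewrite mem_enum.
Qed.

Lemma multi_index_sort (f : {ffun 'I_d -> 'I_n}) : injective f ->
  exists (I : multi_index n d) (s : 'S_d), f = [ffun i => val I (s i)].
Proof.
move=> fI; pose t := sort leq (map val (codom f)).
have szt : size t = d by rewrite size_sort size_map size_codom card_ord.
have ut : uniq t by rewrite sort_uniq (map_inj_uniq val_inj); exact/injectiveP.
have st : sorted ltn t by rewrite ltn_sorted_uniq_leq ut sort_sorted //; exact: leq_total.
have tn (i : 'I_d) : (nth 0%N t i < n)%N.
  have : nth 0%N t i \in t by rewrite mem_nth ?szt.
  by rewrite mem_sort => /mapP[y _ ->]; exact: ltn_ord.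
pose g := [ffun i : 'I_d => Ordinal (tn i)].
have gP : [forall i : 'I_d, forall j : 'I_d, (i < j)%N ==> (g i < g j)%N].
  apply/forallP => i; apply/forallP => j; apply/implyP => ij; rewrite !ffunE /=.
  by apply: (sorted_ltn_nth ssrnat.ltn_trans) => //; rewrite inE szt.
have ft i : val (f i) \in t by rewrite mem_sort map_f // codom_f.
have ft' i : (index (val (f i)) t < d)%N by rewrite -[X in (_ < X)%N]szt index_mem.
have sI : injective (fun i => Ordinal (ft' i)).
  move=> i j [] /(congr1 (nth 0%N t)); rewrite (nth_index _ (ft i)) (nth_index _ (ft j)) => e.
  exact/fI/val_inj.
exists (exist _ g gP), (perm sI); apply/ffunP => i.
by apply/val_inj; rewrite !ffunE permE /= (nth_index _ (ft i)).
Qed.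

Lemma Cauchy_Binet (u v : 'M[R]_(d, n)) :
  \sum_(I : multi_index n d)
    \det (colsub (val I) u) * \det (colsub (val I) v) = \det (u *m v^T).
Proof.
transitivity (\sum_(f : {ffun 'I_d -> 'I_n})
    (\prod_i u i (f i)) * \det (colsub f v)); last first.
  under eq_bigr => f _ do rewrite -det_tr /determinant mulr_sumr.
  rewrite exchange_big; apply: eq_bigr => s _ /=.
  under [in RHS]eq_bigr => i _ do rewrite !mxE.
  rewrite bigA_distr_bigA mulr_sumr; apply: eq_bigr => f _.
  rewrite mulrCA -big_split; congr (_ * _); apply: eq_bigr => i _.
  by rewrite !mxE.
rewrite (bigID (fun f : {ffun _} => injectiveb f)) /= [X in _ + X]big1 ?addr0; last first.
  move=> f /injectivePn[i [j nij fij]]; rewrite -det_tr.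
  rewrite (determinant_alternate nij) ?mulr0 // => k.
  by rewrite !mxE fij.
pose h (p : multi_index n d * 'S_d) := [ffun i => val p.1 (p.2 i)].
have hI : injective h.
  move=> [I s] [J t] /ffunP e /=.
  have eIJ : I = J.
    apply: multi_index_codom => x; apply/codomP/codomP => -[i ->].
      by exists (t (s^-1%g i)); have := e (s^-1%g i); rewrite !ffunE /= permKV.
    by exists (s (t^-1%g i)); have := e (t^-1%g i); rewrite !ffunE /= permKV.
  subst J; congr pair; apply/permP => i; apply: (@multi_index_inj I).
  by have := e i; rewrite !ffunE.
rewrite (eq_bigl (mem (h @: predT))); last first.
  move=> f; apply/injectiveP/imsetP => [/multi_index_sort[I [s ->]]|[[I s] _ ->]].
    by exists (I, s).
  by move=> i j; rewrite !ffunE => /multi_index_inj /perm_inj.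
rewrite big_imset /=; last by move=> ? ? _ _ /hI.
under [RHS]eq_bigl => p do rewrite inE.
rewrite -(pair_bigA _ (fun I s => \prod_i u i (h (I, s) i) * \det (colsub (h (I, s)) v))) /=.
apply: eq_bigr => I _; rewrite {1}/determinant mulr_suml; apply: eq_bigr => s _.
have -> : colsub (h (I, s)) v = col_perm s (colsub (val I) v).
  by apply/matrixP => i j; rewrite !mxE !ffunE.
rewrite col_permE det_mulmx det_perm odd_permV [\det _ * _]mulrC mulrA.
congr (_ * _); rewrite mulrC; congr (_ * _).
by apply: eq_bigr => i _; rewrite !mxE !ffunE.
Qed.
End Cauchy_Binet.

(* The d-th exterior power of R^n, in coordinates with respect to (e_I)_I.
   Its topology is that of a finite-dimensional vector space. *)
Notation extpower R n d := 'rV[R]_#|{: multi_index n d}|.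

(* Since det (e_I(i) . e_J(j))_(i, j) is 1 if I = J and 0 otherwise, the basis
   (e_I)_I is orthonormal for the inner product of the exterior power; see
   ext_dot_wedge below for its value on decomposable vectors. *)
Definition ext_dot (R : realType) n d (xi eta : extpower R n d) : R :=
  \sum_k xi ord0 k * eta ord0 k.

Definition ext_norm (R : realType) n d (xi : extpower R n d) : R :=
  Num.sqrt (ext_dot xi xi).

(* u_0 /\ ... /\ u_(d-1), where the u_i are the rows of u; its coordinate
   along e_I is the minor of u on the columns I. *)
Definition wedge (R : realType) n d (u : 'M[R]_(d, n)) : extpower R n d :=
  \row_(k < #|{: multi_index n d}|) \det (colsub (val (enum_val k)) u).

Lemma ext_dot_wedge (R : realType) n d (u v : 'M[R]_(d, n)) :
  ext_dot (wedge u) (wedge v) = \det (u *m v^T).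
Proof.
rewrite -Cauchy_Binet /ext_dot (reindex_onto (@enum_rank _) (@enum_val _ _)) /=.
  by apply: eq_big => I; rewrite ?mxE ?enum_rankK ?eqxx.
by move=> k _; rewrite enum_valK.
Qed.

(* Oriented d-dimensional subspaces of R^n, as unit vectors of the exterior
   power. The two orientations of the span of the rows of u are the two signs.
   For 0 < d the sign s is redundant (negate a row of u); for d = 0 it
   provides the two orientations of the zero subspace, whose only basis is
   empty. *)
Definition ograss (R : realType) n d : set (extpower R n d) :=
  [set xi | exists (u : 'M[R]_(d, n)) (s : bool),
     row_free u /\ xi = (-1) ^+ s *: ((ext_norm (wedge u))^-1 *: wedge u)].
Arguments ograss : clear implicits.

Lemma ext_norm_wedge_gt0 (R : realType) n d (u : 'M[R]_(d, n)) :
  row_free u -> 0 < ext_norm (wedge u).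
Proof.
move=> uf; rewrite sqrtr_gt0 lt_def; apply/andP; split; last first.
  by apply: sumr_ge0 => k _; rewrite -expr2 sqr_ge0.
rewrite ext_dot_wedge -unitfE -unitmxE -row_free_unit -kermx_eq0.
apply/eqP/row_matrixP => i; rewrite row0.
set x := row i _; have : x *m (u *m u^T) = 0.
  by apply/sub_kermxP; rewrite row_sub.
move/(congr1 (mulmx^~ x^T)); rewrite mul0mx !mulmxA -mulmxA -trmx_mul.
move/matrixP/(_ ord0 ord0); rewrite !mxE => /eqP.
rewrite psumr_eq0 => [|j _]; last by rewrite [_^T _ _]mxE -expr2 sqr_ge0.
move=> /allP xu0; apply: (row_free_inj uf); rewrite mul0mx.
apply/rowP => j; have /eqP := xu0 j (mem_index_enum _).
by rewrite [_^T _ _]mxE -expr2 => /eqP; rewrite sqrf_eq0 => /eqP ->; rewrite mxE.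
Qed.

Lemma ograss_unit (R : realType) n d (xi : extpower R n d) :
  ograss R n d xi -> ext_norm xi = 1.
Proof.
move=> [u [s [/ext_norm_wedge_gt0 u0 ->]]].
rewrite scalerA /ext_norm /ext_dot.
under eq_bigr => k _ do rewrite mxE mulrACA.
rewrite -mulr_sumr -expr2 exprMn sqrr_sign mul1r -/(ext_dot _ _).
have /ltW d0 : 0 < ext_dot (wedge u) (wedge u) by rewrite -sqrtr_gt0.
by rewrite exprVn sqr_sqrtr // mulVf ?sqrtr1 // gt_eqF // -sqrtr_gt0.
Qed.

Lemma ograss_nonempty (R : realType) n (d : 'I_n.+1) :
  exists xi, xi \in ograss R n d.
Proof.
have rf : row_free (pid_mx d : 'M[R]_(d, n)).
  by rewrite /row_free rank_pid_mx // -ltnS.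
exists ((-1) ^+ false *:
  ((ext_norm (wedge (pid_mx d : 'M[R]_(d, n))))^-1 *: wedge (pid_mx d))).
by apply/mem_set; exists (pid_mx d), false.
Qed.

(* set_type carries the induced topology. The dimension is taken in 'I_n.+1,
   i.e. d <= n, so that the type is inhabited. *)
Definition Grass (R : realType) n (d : 'I_n.+1) : Type :=
  set_type (ograss R n d).
Arguments Grass : clear implicits.

HB.instance Definition _ (R : realType) n (d : 'I_n.+1) :=
  Topological.on (Grass R n d).
HB.instance Definition _ (R : realType) n (d : 'I_n.+1) :=
  isPointed.Build (Grass R n d)
    (exist _ (xchoose (ograss_nonempty R d)) (xchooseP (ograss_nonempty R d))).

HB.instance Definition _ (X Y : ptopologicalType) := Pointed.on (X * Y)%type.

Definition borel (X : ptopologicalType) := g_sigma_algebraType (@open X).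

Section functions.
Context (R : realType) (X : ptopologicalType).

Definition C0 : set (X -> R) :=
  [set f | continuous f /\
    forall e : R, 0 < e ->
      exists2 K : set X, compact K & forall x, ~ K x -> `|f x| < e].

Definition sup_norm (f : X -> R) : \bar R :=
  ereal_sup [set `|f x|%:E | x in setT].

End functions.

Section measures.
Context (R : realType) (X : ptopologicalType).

Record radon := Radon {
  radon_measure :> {finite_measure set (borel X) -> \bar R};
  radon_inner : forall A : set (borel X), measurable A ->
    radon_measure A =
    ereal_sup [set radon_measure K |
               K in [set K : set X | compact K /\ K `<=` A]]
}.

Definition pairing (mu : radon) (w : X -> R) : R :=
  \int[mu]_(x in (setT : set (borel X))) w x.

(* (mu - nu | w) *)
Definition diff_pairing (mu nu : radon) (w : X -> R) : R :=
  pairing mu w - pairing nu w.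

Definition d_op (mu nu : radon) : \bar R :=
  ereal_sup [set (diff_pairing mu nu w)%:E |
             w in [set w | C0 w /\ (sup_norm w <= 1%E)%E]].

Definition narrow_cvg (mu_ : nat -> radon) (mu : radon) : Prop :=
  forall w : X -> R, continuous w -> [bounded w x | x in setT] ->
    (fun i => pairing (mu_ i) w) @ \oo --> pairing mu w.

End measures.
Arguments radon : clear implicits.

Definition pd_kernel (R : realType) (X : Type) (k : X -> X -> R) : Prop :=
  (forall x y, k x y = k y x) /\
  (forall m (x : 'I_m -> X) (a : 'I_m -> R),
     0 <= \sum_(i < m) \sum_(j < m) a i * a j * k (x i) (x j)).

(* A Hilbert space of functions on X with reproducing kernel k. By the
   Moore-Aronszajn theorem it exists and is unique when k is positive
   definite. The values of rk_ip outside the space are irrelevant. *)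
Record rkhs (R : realType) (X : Type) (k : X -> X -> R) := Rkhs {
  rk_space : set (X -> R);
  rk_ip : (X -> R) -> (X -> R) -> R;
  rk_norm := fun f => Num.sqrt (rk_ip f f);
  rk_zero : rk_space (fun=> 0);
  rk_lin : forall (a : R) f g, rk_space f -> rk_space g ->
    rk_space (fun x => a * f x + g x);
  rk_ip_sym : forall f g, rk_space f -> rk_space g -> rk_ip f g = rk_ip g f;
  rk_ip_lin : forall (a : R) f g h,
    rk_space f -> rk_space g -> rk_space h ->
    rk_ip (fun x => a * f x + g x) h = a * rk_ip f h + rk_ip g h;
  rk_ip_ge0 : forall f, rk_space f -> 0 <= rk_ip f f;
  rk_ip_eq0 : forall f, rk_space f -> rk_ip f f = 0 -> f = fun=> 0;
  rk_complete : forall f_ : nat -> X -> R,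
    (forall i, rk_space (f_ i)) ->
    (forall e : R, 0 < e -> exists N, forall i j, (N <= i)%N -> (N <= j)%N ->
       rk_norm (fun x => f_ i x - f_ j x) < e) ->
    exists2 f, rk_space f &
      (fun i => rk_norm (fun x => f_ i x - f x)) @ \oo --> (0 : R);
  rk_kernel : forall x, rk_space (k x);
  rk_repro : forall f x, rk_space f -> rk_ip f (k x) = f x
}.

Section dual.
Context (R : realType) (X : ptopologicalType) (k : X -> X -> R) (W : rkhs k).

(* W is contained in C0 and the inclusion is bounded. The inclusion is not
   automatic: k x x need not be a bounded function of x when every k x is
   in C0. *)
Definition embedded_in_C0 : Prop :=
  rk_space W `<=` @C0 R X /\
  exists c : R, forall w, rk_space W w ->
    (sup_norm w <= (c * rk_norm W w)%:E)%E.

(* The norm in the dual of W of the restriction to W of a linear form, with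
   value +oo if this restriction is not bounded. *)
Definition dual_norm (l : (X -> R) -> R) : \bar R :=
  ereal_sup [set `|l w|%:E | w in [set w | rk_space W w /\ rk_norm W w <= 1]].

End dual.

Notation varifold R n d := (radon R ('rV[R]_n * Grass R n d)%type).

Definition prod_kernel (R : realType) (X Y : Type)
    (kX : X -> X -> R) (kY : Y -> Y -> R) : X * Y -> X * Y -> R :=
  fun p q => kX p.1 q.1 * kY p.2 q.2.

(* Main.v *)
(* For convergence in d_op: the unit ball of W is bounded by some C in the
   supremum norm, so the dual norm is at most C d_op.

   For narrow convergence: by the reproducing property, every w in the unit
   ball satisfies |w p - w q|^2 <= Q p q := k p p - 2 k p q + k q q, so the
   ball is uniformly bounded and equicontinuous. Choose a compact K carrying
   almost all the mass of mu and finitely many x_j, with a partition of unity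
   theta_j subordinate to the Q-balls around the x_j up to a defect theta_0
   vanishing on K. Then |w - sum_j w(x_j) theta_j| <= a + C theta_0 for all w
   in the ball, and integrating leaves only the finitely many bounded
   continuous functions 1, theta_0 and theta_j to be tested against
   mu_i - mu. *)
Require Import Defs.
From mathcomp Require Import all_boot all_order all_algebra.
From mathcomp Require Import all_classical all_reals all_analysis.
From mathcomp Require Import ring lra.
Import Order.TTheory GRing.Theory Num.Theory.
Import numFieldNormedType.Exports.
Local Open Scope classical_set_scope.
Local Open Scope ring_scope.
Set Implicit Arguments.
Unset Strict Implicit.

(** * Borel measurability and separation of points *)

Lemma continuous_borel_measurable (R : realType) (X : ptopologicalType)
  (f : X -> R) : continuous f -> measurable_fun [set: borel X] f.
Proof.
move=> /continuousP cf.
apply: (measurability _ (measurable_realfun.RGenOpens.measurableE R)).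
move=> _ [_ [a [b ->] <-]]; rewrite setTI.
by apply: sub_sigma_algebra; exact/cf/interval_open.
Qed.

(** If [p] and [q] have no disjoint neighbourhoods, neither do [f p] and [f q], which then agree
    because the real line is Hausdorff. *)
Lemma functionally_hausdorff (R : realType) (X : topologicalType) :
  (forall p q : X,
     (forall f : X -> R, continuous f -> f p = f q) -> p = q) ->
  hausdorff_space X.
Proof.
move=> sepX p q pq; apply: sepX => f cf; apply: (@Rhausdorff R) => A B fA fB.
by have [z [Az Bz]] := pq _ _ (cf p _ fA) (cf q _ fB); exists (f z).
Qed.

Lemma compact_borel_measurable (X : ptopologicalType) (K : set X) :
  hausdorff_space X -> compact K -> measurable (K : set (borel X)).
Proof.
move=> hX /(compact_closed hX)/closed_openC oK.
rewrite -[K]setCK; apply: measurableC.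
exact: sub_sigma_algebra.
Qed.

(** * Closure properties of bounded continuous functions *)

Definition bounded_continuous (R : realType) (X : topologicalType)
  (f : X -> R) : Prop := continuous f /\ exists M, forall x, `|f x| <= M.

Section bounded_continuous_theory.
Context (R : realType) (X : ptopologicalType).
Implicit Types f g : X -> R.

Lemma bounded_continuous_cst (a : R) : bounded_continuous (fun _ : X => a).
Proof. by split; [exact: cst_continuous|exists `|a|]. Qed.

Lemma bounded_continuousD f g : bounded_continuous f -> bounded_continuous g ->
  bounded_continuous (fun x => f x + g x).
Proof.
move=> [cf [M fM]] [cg [N gN]]; split.
  by move=> x; apply: cvgD; [exact: cf|exact: cg].
by exists (M + N) => x; rewrite (le_trans (ler_normD _ _))// lerD.
Qed.

Lemma bounded_continuousZ (a : R) f : bounded_continuous f ->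
  bounded_continuous (fun x => a * f x).
Proof.
move=> [cf [M fM]]; split; first by move=> x; apply: cvgMl_tmp; exact: cf.
by exists (`|a| * M) => x; rewrite normrM ler_wpM2l.
Qed.

Lemma bounded_continuous_norm f : bounded_continuous f ->
  bounded_continuous (fun x => `|f x|).
Proof.
move=> [cf [M fM]]; split; first by move=> x; apply: cvg_norm; exact: cf.
by exists M => x; rewrite normr_id.
Qed.

Lemma bounded_continuous_sum (I : Type) (r : seq I) (F : I -> X -> R) :
  (forall i, bounded_continuous (F i)) ->
  bounded_continuous (fun x => \sum_(i <- r) F i x).
Proof.
move=> bF; elim: r => [|i r IHr].
  under eq_fun do rewrite big_nil; exact: bounded_continuous_cst.
under eq_fun do rewrite big_cons; exact: bounded_continuousD.
Qed.

End bounded_continuous_theory.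

(** * Integration against a Radon measure *)

Section pairing_theory.
Context (R : realType) (X : ptopologicalType) (mu : radon R X).
Implicit Types f g : X -> R.

Lemma bounded_continuous_integrable f : bounded_continuous f ->
  mu.-integrable setT (EFin \o f : borel X -> \bar R).
Proof.
move=> [cf [M fM]]; apply: measurable_bounded_integrable => //.
- by rewrite ltey_eq fin_num_measure.
- exact: continuous_borel_measurable.
- exists M; split; first exact: num_real.
  by move=> N /ltW MN x _; exact: le_trans MN.
Qed.

Lemma pairingD f g : bounded_continuous f -> bounded_continuous g ->
  pairing mu (fun x => f x + g x) = pairing mu f + pairing mu g.
Proof.
by move=> bf bg; apply: RintegralD => //; exact: bounded_continuous_integrable.
Qed.

Lemma pairingZ (a : R) f : bounded_continuous f ->
  pairing mu (fun x => a * f x) = a * pairing mu f.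
Proof.
by move=> bf; apply: RintegralZl => //; exact: bounded_continuous_integrable.
Qed.

Lemma pairing_cst (a : R) :
  pairing mu (fun=> a) = a * fine (mu setT).
Proof. exact: Rintegral_cst. Qed.

Lemma pairing_sum (I : Type) (r : seq I) (F : I -> X -> R) :
  (forall i, bounded_continuous (F i)) ->
  pairing mu (fun x => \sum_(i <- r) F i x) = \sum_(i <- r) pairing mu (F i).
Proof.
move=> bF; elim: r => [|i r IHr].
  by rewrite big_nil; under eq_fun do rewrite big_nil; rewrite pairing_cst mul0r.
rewrite big_cons -IHr -pairingD//; last exact: bounded_continuous_sum.
by under eq_fun do rewrite big_cons.
Qed.

Lemma ler_norm_pairing f g : bounded_continuous f -> bounded_continuous g ->
  (forall x, `|f x| <= g x) -> `|pairing mu f| <= pairing mu g.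
Proof.
move=> bf bg fg; apply: le_trans (le_normr_Rintegral _ _) _ => //.
  exact: bounded_continuous_integrable.
apply: le_Rintegral => //; apply: bounded_continuous_integrable => //.
exact: bounded_continuous_norm.
Qed.

(** [f] lies below the indicator of the complement of [K], whose integral is the mass outside
    [K]. *)
Lemma pairing_le_compl (K : set X) f : hausdorff_space X -> compact K ->
  bounded_continuous f -> (forall x, f x <= 1) -> (forall x, K x -> f x = 0) ->
  pairing mu f <= fine (mu setT) - fine (mu K).
Proof.
move=> hX /(compact_borel_measurable hX) mK bf f1 fK.
have mKC : measurable (~` (K : set (borel X))) by exact: measurableC.
have -> : fine (mu setT) - fine (mu K) =
    \int[mu]_(x in (setT : set (borel X))) (\1_(~` (K : set (borel X))) x).
  rewrite /Rintegral integral_indic// setIT -(setUv K) measureU ?setICr//.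
  by rewrite fineD ?fin_num_measure// addrC addKr.
apply: le_Rintegral => //; first exact: bounded_continuous_integrable.
  exact: integrable_indic.
move=> x _; rewrite indicE; case: (asboolP (K x)) => Kx.
  by rewrite fK// ler0n.
by rewrite mem_set.
Qed.

End pairing_theory.

(** * Narrow convergence, uniformly over an equicontinuous family *)

(* theta x = max (0, e - Q x) / max (S, e / 2), where S is the sum over s of the
   numerators: the floor e / 2 makes the quotient continuous, and S >= e / 2
   on K. The defect theta0 is the part of the unit mass not covered by s. *)
Lemma subordinate_partition (R : realType) (X : ptopologicalType)
  (Q : X -> X -> R) (K : set X) (e : R) :
  (forall x, continuous (Q x)) -> (forall x y, 0 <= Q x y) ->
  (forall x, Q x x = 0) -> compact K -> 0 < e ->
  exists (s : seq X) (theta : X -> X -> R) (theta0 : X -> R),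
    [/\ forall x, bounded_continuous (theta x) /\ forall y,
          0 <= theta x y /\ (0 < theta x y -> Q x y <= e),
        bounded_continuous theta0,
        forall y, 0 <= theta0 y <= 1,
        forall y, K y -> theta0 y = 0 &
        forall y, \sum_(x <- s) theta x y + theta0 y = 1].
Proof.
move=> cQ Q0 Qxx; rewrite compact_cover => cK e0.
have e20 : 0 < e / 2 by rewrite divr_gt0.
(* The balls have half the radius [e] used in [phi], so each [y] in [K] has [phi x y > e / 2] for
   some [x] in [s]. *)
have [s Ks] : exists s : seq X,
    forall y, K y -> exists2 x, x \in s & Q x y < e / 2.
  have [x _||s _ Ks] := cK X K (fun x => Q x @^-1` [set t | t < e / 2]).
  - by apply: open_comp => [? _|]; [exact: cQ|exact: open_lt].
  - by move=> x Kx; exists x => //=; rewrite Qxx.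
  - by exists (finmap.enum_fset s) => y /Ks[x xs Qxy]; exists x.
pose phi x y : R := Num.max 0 (e - Q x y).
pose S y := \sum_(x <- s) phi x y.
pose m y : R := Num.max (S y) (e / 2).
have phi0 x y : 0 <= phi x y by rewrite le_max lexx.
have phie x y : phi x y <= e by rewrite ge_max (ltW e0) gerBl Q0.
have cphi x : continuous (phi x).
  move=> y; apply: (@continuous_max _ _ (fun=> 0) (fun y => e - Q x y)).
    exact: cst_continuous.
  by apply: cvgB; [exact: cvg_cst|exact: cQ].
have bphi x : bounded_continuous (phi x).
  by split=> //; exists e => y; rewrite ger0_norm.
have bS : bounded_continuous S by exact: bounded_continuous_sum.
have S0 y : 0 <= S y by exact: sumr_ge0.
have m0 y : 0 < m y by rewrite lt_max e20 orbT.
have cmV : continuous (fun y => (m y)^-1).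
  move=> y; apply: cvgV; first by rewrite gt_eqF.
  apply: (@continuous_max _ _ S (fun=> e / 2)); first exact: bS.1.
  exact: cst_continuous.
have bdiv (f : X -> R) : bounded_continuous f ->
    bounded_continuous (fun y => f y / m y).
  move=> [cf [M fM]]; split.
    by move=> y; apply: cvgM; [exact: cf|exact: cmV].
  exists (M / (e / 2)) => y; rewrite normrM normfV (gtr0_norm (m0 y)).
  apply: ler_pM => //; first by rewrite invr_ge0 ltW.
  by rewrite lef_pV2 ?posrE// le_max lexx orbT.
exists s, (fun x y => phi x y / m y), (fun y => 1 - S y / m y).
split.
- move=> x; split=> [|y]; first exact: bdiv.
  split; first by rewrite divr_ge0// ltW.
  by rewrite pmulr_lgt0 ?invr_gt0// lt_max ltxx/= subr_gt0 => /ltW.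
- apply: bounded_continuousD; first exact: bounded_continuous_cst.
  by under eq_fun do rewrite -mulN1r; apply/bounded_continuousZ/bdiv.
- move=> y; rewrite subr_ge0 gerBl divr_ge0 ?(ltW (m0 y))// andbT.
  by rewrite ler_pdivrMr// mul1r le_max lexx.
- move=> y /Ks[x xs Qxy]; suff -> : m y = S y.
    rewrite divff ?subrr// gt_eqF// (lt_le_trans e20)//.
    rewrite /S (big_rem x xs)/= -[leLHS]addr0 lerD ?sumr_ge0//.
    by rewrite le_max; apply/orP; right; lra.
  apply/max_idPl; rewrite /S (big_rem x xs)/= -[leLHS]addr0.
  by rewrite lerD ?sumr_ge0// le_max; apply/orP; right; lra.
- by move=> y; rewrite -mulr_suml addrCA subrr addr0.
Qed.

(** Since [Q x] is continuous and vanishes at [x], the modulus [Q] makes [F] equicontinuous. The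
    compact set is chosen for [mu] alone; testing against the defect [th0] transfers the smallness
    of the mass far from it to the [mu_ i]. *)
Lemma narrow_cvg_uniform (R : realType) (X : ptopologicalType)
  (mu_ : nat -> radon R X) (mu : radon R X) (Q : X -> X -> R)
  (F : set (X -> R)) (C : R) :
  hausdorff_space X -> narrow_cvg mu_ mu ->
  (forall x, continuous (Q x)) -> (forall x y, 0 <= Q x y) ->
  (forall x, Q x x = 0) -> 0 <= C ->
  (forall f, F f -> continuous f /\ forall x, `|f x| <= C) ->
  (forall f, F f -> forall x y, (f x - f y) ^+ 2 <= Q x y) ->
  forall e : R, 0 < e ->
    \forall i \near \oo, forall f, F f -> `|diff_pairing (mu_ i) mu f| <= e.
Proof.
move=> hX mucvg cQ Q0 Qxx C0 FC FQ e e0.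
have {}mucvg w : bounded_continuous w ->
    pairing (mu_ i) w @[i --> \oo] --> pairing mu w.
  move=> [cw [M wM]]; apply: mucvg => //; exists M; split; first exact: num_real.
  by move=> N /ltW MN x _; exact: le_trans MN.
pose M := pairing mu (fun=> 1).
have M0 : 0 <= M by rewrite /M pairing_cst mul1r fine_ge0.
(* With these values 2aM + 2Cb = e - 2a - 2b, strictly below [e]; the added 1 also keeps the
   denominators positive. *)
pose a := e / (4 * (M + 1)); pose b := e / (4 * (C + 1)).
have a0 : 0 < a by rewrite divr_gt0// mulr_gt0// ltr_wpDl.
have b0 : 0 < b by rewrite divr_gt0// mulr_gt0// ltr_wpDl.
have [K cK Kb] : exists2 K : set X, compact K &
    fine (mu setT) - fine (mu K) <= b.
  have : mu setT \is a fin_num by exact: fin_num_measure.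
  rewrite (radon_inner mu measurableT) => supfin.
  have [_ [K [cK _] <-]] := ub_ereal_sup_adherent b0 supfin.
  rewrite -(radon_inner mu measurableT) => ltK; exists K => //.
  have mK := compact_borel_measurable hX cK.
  move: ltK; rewrite -[mu setT]fineK ?fin_num_measure//.
  rewrite -[X in (_ < X)%E]fineK ?fin_num_measure// -EFinB lte_fin => ?.
  by rewrite lerBlDr -lerBlDl; exact: ltW.
(* The level is the square of [a] because [Q] bounds squared differences: [|f y - f x| <= a]
   wherever [th x y > 0]. *)
have [s [th [th0 [thP bth0 th01 th0K thsum]]]] :=
  subordinate_partition cQ Q0 Qxx cK (exprn_gt0 2 a0).
have bth x : bounded_continuous (th x) by case: (thP x).
have th_ge0 x y : 0 <= th x y by case: (thP x) => _ /(_ y)[].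
have b1 : bounded_continuous (fun _ : X => 1 : R).
  exact: bounded_continuous_cst.
pose g f y := \sum_(x <- s) f x * th x y.
have bg f : bounded_continuous (g f).
  by apply: bounded_continuous_sum => x; exact: bounded_continuousZ.
have bF f : F f -> bounded_continuous f.
  by move=> /FC[cf fC]; split=> //; exists C.
(* As the [th x] and [th0] sum to 1, f - g f is the sum of the (f - f x) * th x plus f * th0. The
   first part is at most [a] in absolute value, the second at most C * th0. *)
have fg nu f : F f ->
    `|pairing nu (fun y => f y + -1 * g f y)| <=
    a * pairing nu (fun=> 1) + C * pairing nu th0.
  move=> Ff; rewrite -!pairingZ// -pairingD; do ?exact: bounded_continuousZ.
  apply: ler_norm_pairing.
  - by apply: bounded_continuousD; [exact: bF|exact: bounded_continuousZ].
  - by apply: bounded_continuousD; exact: bounded_continuousZ.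
  move=> y; have -> : f y + -1 * g f y =
      \sum_(x <- s) (f y - f x) * th x y + f y * th0 y.
    under eq_bigr do rewrite mulrBl.
    rewrite sumrB -mulr_sumr mulN1r addrAC -mulrDr thsum mulr1.
    by [].
  apply: le_trans (ler_normD _ _) _; apply: lerD; last first.
    rewrite normrM (ger0_norm (x := th0 y)); last by case/andP: (th01 y).
    by rewrite ler_wpM2r//; [case/andP: (th01 y)|case: (FC _ Ff)].
  apply: (@le_trans _ _ (a * \sum_(x <- s) th x y)); last first.
    rewrite ler_wpM2l ?(ltW a0)// -(thsum y) lerDl; by case/andP: (th01 y).
  rewrite mulr_sumr; apply: le_trans (ler_norm_sum _ _ _) _.
  apply: ler_sum => x _; rewrite normrM (ger0_norm (th_ge0 x y)).
  have [->|th0'] := eqVneq (th x y) 0; first by rewrite !mulr0.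
  rewrite ler_wpM2r// -ler_sqr ?nnegrE ?(ltW a0)// real_normK ?num_real//.
  rewrite -sqrrN opprB (le_trans (FQ _ Ff x y))//.
  by case: (thP x) => _ /(_ y)[_]; apply; rewrite lt_def th0'/=.
(* A bound for [|diff_pairing (mu_ i) mu f|] in which [f] does not occur, hence uniform over [F];
   its last sum tends to 0. *)
pose B i := (a * (pairing (mu_ i) (fun=> 1) + M) +
  C * (pairing (mu_ i) th0 + pairing mu th0)) +
  \sum_(x <- s) C * `|pairing (mu_ i) (th x) - pairing mu (th x)|.
have Bcvg : B i @[i --> \oo] --> (a * (M + M) +
    C * (pairing mu th0 + pairing mu th0)) +
    \sum_(x <- s) C * `|pairing mu (th x) - pairing mu (th x)|.
  apply: cvgD.
    by apply: cvgD; apply: cvgMl_tmp; apply: cvgD;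
      [exact: mucvg|exact: cvg_cst|exact: mucvg|exact: cvg_cst].
  apply: (cvg_big (op := +%R)) => [|x _]; first exact: add_continuous.
  apply: cvgMl_tmp; apply: cvg_norm.
  by apply: cvgB; [exact: mucvg|exact: cvg_cst].
have limB : (a * (M + M) + C * (pairing mu th0 + pairing mu th0)) +
    \sum_(x <- s) C * `|pairing mu (th x) - pairing mu (th x)| < e.
  rewrite big1 ?addr0; last by move=> x _; rewrite subrr normr0 mulr0.
  have : pairing mu th0 <= b.
    apply: le_trans Kb; apply: pairing_le_compl => //.
    by move=> y; case/andP: (th01 y).
  have aM : a * (M + 1) = e / 4.
    by rewrite /a; field; apply/eqP; lra.
  have bC : b * (C + 1) = e / 4.
    by rewrite /b; field; apply/eqP; lra.
  move=> /(ler_wpM2l C0); lra.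
have nearB : \forall i \near \oo, B i <= e := cvgr_le _ Bcvg e limB.
near=> i; have Bi : B i <= e by near: i; exact: nearB.
move=> f Ff.
apply: le_trans Bi; rewrite /diff_pairing.
(* In the finite sum [f] enters only through the numbers [f x], each bounded by [C]. *)
have dec nu : pairing nu f =
    pairing nu (fun y => f y + -1 * g f y) +
    \sum_(x <- s) f x * pairing nu (th x).
  under eq_bigr do rewrite -pairingZ//.
  rewrite -(@pairing_sum _ _ nu _ s (fun x y => f x * th x y)); last first.
    by move=> x; exact: bounded_continuousZ.
  rewrite pairingD; [|exact: bF|exact: bounded_continuousZ].
  by rewrite pairingZ// mulN1r subrK.
rewrite (dec (mu_ i)) (dec mu) opprD addrACA -sumrB.
apply: le_trans (ler_normD _ _) _; apply: lerD.
  apply: le_trans (ler_normB _ _) _.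
  apply: le_trans (lerD (fg _ _ Ff) (fg _ _ Ff)) _.
  rewrite /M; lra.
apply: le_trans (ler_norm_sum _ _ _) _; apply: ler_sum => x _.
by rewrite -mulrBr normrM ler_wpM2r//; case: (FC _ Ff).
Unshelve. all: by end_near. Qed.

(** * Modulus of continuity of the unit ball of a reproducing kernel Hilbert space *)

Section rkhs_theory.
Context (R : realType) (X : Type) (k : X -> X -> R) (W : rkhs k).

(** The quadratic polynomial [quad], the squared norm of a f + g, is nonnegative; it is evaluated at
    its minimiser -B/A. *)
Lemma rkhs_Cauchy_Schwarz f g : rk_space W f -> rk_space W g ->
  rk_ip W f g ^+ 2 <= rk_ip W f f * rk_ip W g g.
Proof.
move=> Wf Wg; have quad a :
    0 <= a * (a * rk_ip W f f + rk_ip W f g) + (a * rk_ip W f g + rk_ip W g g).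
  have Wh : rk_space W (fun x => a * f x + g x) by exact: rk_lin.
  have := rk_ip_ge0 Wh.
  rewrite rk_ip_lin// (rk_ip_sym Wf Wh) (rk_ip_sym Wg Wh) !rk_ip_lin//.
  by rewrite (rk_ip_sym Wg Wf).
move: (rk_ip_ge0 Wf) (rk_ip_ge0 Wg) quad.
move: (rk_ip W f f) (rk_ip W f g) (rk_ip W g g) => A B D.
rewrite le_eqVlt => /predU1P[<-|A0] D0 quad.
  (* For A = 0 the polynomial is 2aB + D; a nonzero [B] would let it take the negative value -D -
     2. *)
  have [->|B0] := eqVneq B 0; first by rewrite expr0n mul0r.
  have := quad (- (D + 1) / B).
  have -> : - (D + 1) / B * (- (D + 1) / B * 0 + B) + (- (D + 1) / B * B + D) =
    - D - 2 by field.
  by move=> ?; lra.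
have := quad (- B / A).
have -> : - B / A * (- B / A * A + B) + (- B / A * B + D) = D - B ^+ 2 / A.
  by field; exact: lt0r_neq0.
by rewrite subr_ge0 ler_pdivrMr// mulrC.
Qed.

(** The element of [W] representing w x - w y, written in the form a f + g of [rk_lin]. *)
Let kdiff x y := fun z => -1 * k y z + k x z.

Let kdiff_space x y : rk_space W (kdiff x y).
Proof. by apply: rk_lin; exact: rk_kernel. Qed.

Let rk_ip_kdiff w x y : rk_space W w -> rk_ip W w (kdiff x y) = w x - w y.
Proof.
move=> Ww; have Wk z := rk_kernel W z.
rewrite rk_ip_sym// rk_ip_lin// 2?(rk_ip_sym (Wk _) Ww) !rk_repro//.
by rewrite mulN1r addrC.
Qed.

Let rk_ip_kdiff2 x y :
  rk_ip W (kdiff x y) (kdiff x y) = k x x - 2 * k x y + k y y.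
Proof.
rewrite rk_ip_kdiff// /kdiff.
(* k x y is the inner product of [k x] and [k y], so the kernel inherits its symmetry. *)
have -> : k x y = k y x.
  have Wk z := rk_kernel W z.
  by rewrite -(rk_repro y (Wk x)) rk_ip_sym// rk_repro.
by ring.
Qed.

Lemma kernel_dist_ge0 x y : 0 <= k x x - 2 * k x y + k y y.
Proof. by rewrite -rk_ip_kdiff2; exact: rk_ip_ge0. Qed.

(** Cauchy-Schwarz applied to [w] and [kdiff x y], whose squared norm is the right-hand side. *)
Lemma rkhs_unit_ball_modulus w x y : rk_space W w -> rk_norm W w <= 1 ->
  (w x - w y) ^+ 2 <= k x x - 2 * k x y + k y y.
Proof.
move=> Ww w1; rewrite -rk_ip_kdiff// -rk_ip_kdiff2.
apply: le_trans (rkhs_Cauchy_Schwarz Ww (kdiff_space x y)) _.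
rewrite -[leRHS]mul1r ler_wpM2r ?rk_ip_ge0//.
by rewrite -(sqr_sqrtr (rk_ip_ge0 Ww)) expr_le1 ?sqrtr_ge0.
Qed.

End rkhs_theory.

(** * Convergence in the dual norm *)

Section dual_norm_cvg.
Context (R : realType) (X : ptopologicalType) (k : X -> X -> R) (W : rkhs k).
Context (W_C0 : embedded_in_C0 W).

Let unit_ball := [set w | rk_space W w /\ rk_norm W w <= 1].

Lemma unit_ball_bounded : exists2 C : R, 1 <= C &
  forall w, unit_ball w -> continuous w /\ forall x, `|w x| <= C.
Proof.
(* The embedding constant [c] may be zero or negative; the maximum with 1 allows division by [C]
   later. *)
have [WC0 [c Wc]] := W_C0; exists (Num.max c 1).
  by rewrite le_max lexx orbT.
move=> w [Ww w1]; split=> [|x]; first by case: (WC0 _ Ww).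
rewrite -lee_fin; apply: (@le_trans _ _ (sup_norm w)).
  by apply: ereal_sup_ubound; exists x.
apply: le_trans (Wc _ Ww) _; rewrite lee_fin le_max.
have n0 : 0 <= rk_norm W w by exact: sqrtr_ge0.
have [c0|/ltW c0] := leP 0 c; apply/orP; [left|right].
  by rewrite ler_piMr.
by rewrite (le_trans _ ler01)// mulr_le0_ge0.
Qed.

Lemma dual_norm_ge0 (mu nu : radon R X) :
  (0 <= dual_norm W (diff_pairing mu nu))%E.
Proof.
apply: (@le_trans _ _ `|diff_pairing mu nu (fun=> 0)|%:E).
  by rewrite lee_fin.
apply: ereal_sup_ubound; exists (fun=> 0) => //; split; first exact: rk_zero.
have W0 := rk_zero W.
have -> : rk_norm W (fun=> 0) = 0; last exact: ler01.
(* Linearity at the zero function with coefficient -1 reads <0,0> = -<0,0> + <0,0>, so the norm of 0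
   vanishes. *)
rewrite /rk_norm; have := rk_ip_lin (-1) W0 W0 W0.
under eq_fun do rewrite mulr0 addr0.
by rewrite mulN1r addNr => ->; rewrite sqrtr0.
Qed.

Lemma dual_norm_cvg0 (mu_ : nat -> radon R X) (mu : radon R X) :
  (forall e : R, 0 < e -> \forall i \near \oo,
     forall w, unit_ball w -> `|diff_pairing (mu_ i) mu w| <= e) ->
  dual_norm W (diff_pairing (mu_ i) mu) @[i --> \oo] --> 0%E.
Proof.
move=> mucvg.
have le_e e : 0 < e -> \forall i \near \oo,
    (dual_norm W (diff_pairing (mu_ i) mu) <= e%:E)%E.
  move=> e0; near=> i; apply: ge_ereal_sup => _ [w Bw <-]; rewrite lee_fin.
  by move: w Bw; near: i; exact: mucvg.
apply/fine_cvgP; split.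
  (* The dual norm takes extended real values; the bound with e = 1 makes it eventually finite. *)
  near=> i; rewrite ge0_fin_numE ?dual_norm_ge0//.
  by apply: (@le_lt_trans _ _ 1%:E); [near: i; exact: le_e|rewrite ltry].
apply/cvgr0Pnorm_le => e e0; near=> i.
have de : (dual_norm W (diff_pairing (mu_ i) mu) <= e%:E)%E.
  by near: i; exact: le_e.
rewrite /= ger0_norm ?fine_ge0 ?dual_norm_ge0// -lee_fin fineK//.
by rewrite ge0_fin_numE ?dual_norm_ge0// (le_lt_trans de)// ltry.
Unshelve. all: by end_near. Qed.

(** For [w] in the unit ball, w / C lies in [C0] with supremum norm at most 1, so it is admissible
    in [d_op]. *)
Lemma d_op_cvg_dual_norm (mu_ : nat -> radon R X) (mu : radon R X) :
  d_op (mu_ i) mu @[i --> \oo] --> 0%E ->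
  dual_norm W (diff_pairing (mu_ i) mu) @[i --> \oo] --> 0%E.
Proof.
move=> /fine_cvgP[dfin dcvg]; apply: dual_norm_cvg0 => e e0.
have [C C1 BC] := unit_ball_bounded.
have C0 : 0 < C by exact: lt_le_trans C1.
have {}dcvg := cvgr_lt _ dcvg (e / C) (divr_gt0 e0 C0).
near=> i.
have di : (d_op (mu_ i) mu <= (e / C)%:E)%E.
  rewrite -[leLHS]fineK; last by near: i; exact: dfin.
  by rewrite lee_fin ltW//; near: i; exact: dcvg.
move=> w Bw; have [cw wC] := BC _ Bw.
have bw : bounded_continuous w by split=> //; exists C.
(* [d_op] is a supremum without absolute values, so both signs of [w] are tested. *)
have scale (s : R) : `|s| = 1 -> s * diff_pairing (mu_ i) mu w <= e.
  move=> s1;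
  have : ((diff_pairing (mu_ i) mu (fun x => s / C * w x))%:E <= (e / C)%:E)%E.
    apply: le_trans di; apply: ereal_sup_ubound.
    exists (fun x => s / C * w x) => //; split.
      apply: W_C0.1; have := rk_lin (s / C) Bw.1 (rk_zero W).
      by under eq_fun do rewrite addr0.
    apply: ge_ereal_sup => _ [x _ <-]; rewrite lee_fin normrM normf_div s1.
    by rewrite (gtr0_norm C0) mulrC mul1r ler_pdivrMr// mul1r.
  rewrite lee_fin /diff_pairing !pairingZ// -mulrBr.
  by rewrite mulrAC ler_pM2r// invr_gt0.
rewrite ler_norml -lerNl -mulN1r -[X in _ && (X <= _)]mul1r.
by rewrite !scale ?normrN ?normr1.
Unshelve. all: by end_near. Qed.

Lemma narrow_cvg_dual_norm (mu_ : nat -> radon R X) (mu : radon R X) :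
  hausdorff_space X -> (forall x, continuous (k x)) ->
  continuous (fun x => k x x) -> narrow_cvg mu_ mu ->
  dual_norm W (diff_pairing (mu_ i) mu) @[i --> \oo] --> 0%E.
Proof.
move=> hX ck cdiag mucvg; apply: dual_norm_cvg0.
have [C C1 BC] := unit_ball_bounded.
apply: (narrow_cvg_uniform (Q := fun x y => k x x - 2 * k x y + k y y)
  hX mucvg _ (kernel_dist_ge0 W) _ (le_trans ler01 C1) BC).
- move=> x y; apply: cvgD; last exact: cdiag.
  by apply: cvgB; [exact: cvg_cst|apply: cvgMl_tmp; exact: ck].
- by move=> x; ring.
- by move=> w [Ww w1] x y; exact: rkhs_unit_ball_modulus x y Ww w1.
Qed.

End dual_norm_cvg.

(** * The space of positions and oriented planes, and its product kernel *)

Lemma continuous_comp2 (X Y Z V : topologicalType) (f : Y -> Z -> V)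
  (u : X -> Y) (v : X -> Z) : continuous (fun p => f p.1 p.2) ->
  continuous u -> continuous v -> continuous (fun x => f (u x) (v x)).
Proof. by move=> cf cu cv x; exact: cvg_comp2 (cu x) (cv x) (cf (u x, v x)). Qed.

(** The coordinates of the position and of the unit multivector are continuous and separate
    points. *)
Lemma varifold_space_hausdorff (R : realType) (n : nat) (d : 'I_n.+1) :
  hausdorff_space ('rV[R]_n * Grass R n d)%type.
Proof.
apply: (@functionally_hausdorff R) => -[x S] [y T] eqf; congr pair.
  apply/rowP => j; apply: (eqf (fun p : _ * Grass R n d => p.1 ord0 j)) => p.
  apply: (@continuous_comp _ _ _ fst (fun v : 'rV[R]_n => v ord0 j)).
    exact: cvg_fst.
  exact: coord_continuous.
apply/val_inj/rowP => j.
apply: (eqf (fun p : _ * Grass R n d => (val p.2 : extpower R n d) ord0 j)) => p.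
apply: (@continuous_comp _ _ _ (fun p : 'rV[R]_n * Grass R n d => val p.2)
  (fun v : extpower R n d => v ord0 j)); last exact: coord_continuous.
apply: (@continuous_comp _ _ _ snd (val : Grass R n d -> extpower R n d)).
  exact: cvg_snd.
exact: initial_continuous.
Qed.

Unset Implicit Arguments.
Set Strict Implicit.

Theorem proposition3p8 (R : realType) (n : nat) (d : 'I_n.+1)
  (kpos : 'rV[R]_n -> 'rV[R]_n -> R)
  (kG : Grass R n d -> Grass R n d -> R)
  (kpos_pd : pd_kernel kpos)
  (kpos_cont : continuous (fun p : 'rV[R]_n * 'rV[R]_n => kpos p.1 p.2))
  (kpos_C0 : forall x : 'rV[R]_n, C0 (kpos x))
  (kG_pd : pd_kernel kG)
  (kG_cont : continuous (fun p : Grass R n d * Grass R n d => kG p.1 p.2))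
  (W : rkhs (prod_kernel kpos kG))
  (W_C0 : embedded_in_C0 W)
  (mu_ : nat -> varifold R n d) (mu : varifold R n d)
  (mu_cvg : (fun i => d_op (mu_ i) mu) @ \oo --> 0%E \/ narrow_cvg mu_ mu) :
  (fun i => dual_norm W (diff_pairing (mu_ i) mu)) @ \oo --> 0%E.
Proof.
case: mu_cvg; first exact: d_op_cvg_dual_norm.
apply: narrow_cvg_dual_norm => //; first exact: varifold_space_hausdorff.
(* Joint continuity of both factors gives continuity of the kernel in its second argument, and then
   along the diagonal. *)
- move=> p q; apply: cvgM.
    apply: (continuous_comp2 (u := fun=> p.1) (v := fst) kpos_cont) => ?.
      exact: cvg_cst.
    exact: cvg_fst.
  apply: (continuous_comp2 (u := fun=> p.2) (v := snd) kG_cont) => ?.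
    exact: cvg_cst.
  exact: cvg_snd.
- move=> q; apply: cvgM.
    by apply: (continuous_comp2 (u := fst) (v := fst) kpos_cont) => ?;
      exact: cvg_fst.
  by apply: (continuous_comp2 (u := snd) (v := snd) kG_cont) => ?;
    exact: cvg_snd.
Qed.
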